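(* Let $X$ be a $t$-dependent vector field on $\mathbb{R}^{n_0}$ admitting a mixed superposition rule $(\Phi,X_{(1)},\dots,X_{(m)})$, $\Phi:\mathbb{R}^{n_1}\times\cdots\times\mathbb{R}^{n_m}\times\mathbb{R}^{n_0}\to\mathbb{R}^{n_0}$, where $X_{(1)},\dots,X_{(m)}$ are Lie systems on $\mathbb{R}^{n_1},\dots,\mathbb{R}^{n_m}$. Suppose that for some $k\in\mathbb{R}^{n_0}$ the map $\Phi_k:(x_{(1)},\dots,x_{(m)})\mapsto\Phi(x_{(1)},\dots,x_{(m)};k)$ has open and dense image in $\mathbb{R}^{n_0}$. Let $\widehat X=X_{(1)}\times\cdots\times X_{(m)}$. Then $\widehat X$ is a Lie system, every element of $V^{\widehat X}$ is $\Phi_k$-projectable (it is $\Phi_k$-related to a vector field on $\mathbb{R}^{n_0}$), and the tangent map of $\Phi_k$ induces a Lie algebra epimorphism $\Phi_{k*}:V^{\widehat X}\to V^X$; in particular $X^t=\Phi_{k*}\widehat X^t$ for all $t$.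
   Context: All objects are real and smooth. A $t$-dependent vector field $X$ on $\mathbb{R}^n$ is a smooth family $\{X^t\}_{t\in\mathbb{R}}$ of vector fields; its particular solutions are solutions of $dx/dt=X(t,x)$. $V^X={\rm Lie}(\{X^t\}_{t\in\mathbb{R}})$ is the smallest real Lie algebra of vector fields containing all $X^t$; $X$ is a Lie system iff $V^X$ is finite-dimensional. The direct product of $X_{(a)}$ on $\mathbb{R}^{n_a}$ is $\sum_a\sum_i X^i_{(a)}(t,x_{(a)})\partial/\partial x^i_{(a)}$ on the product space. A mixed superposition rule $(\Phi,X_{(1)},\dots,X_{(m)})$ for $X$: a $t$-independent map $\Phi$ such that the general solution of $X$ is $x(t)=\Phi(x_{(1)}(t),\dots,x_{(m)}(t);k)$ for a generic family of particular solutions $x_{(a)}(t)$ of $X_{(a)}$ and constants $k\in\mathbb{R}^{n_0}$ (with $k\mapsto\Phi(p;k)$ a local diffeomorphism for generic $p$). *)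

(* Defs.v *)
From HB Require Import structures.
From mathcomp Require Import all_boot all_order all_algebra.
From mathcomp Require Import all_classical all_reals all_analysis.
Set Implicit Arguments.
Unset Strict Implicit.
Unset Printing Implicit Defensive.
Import Order.TTheory GRing.Theory Num.Theory.
Import numFieldNormedType.Exports.
Local Open Scope classical_set_scope.
Local Open Scope ring_scope.

Section Defs.
Variable R : realType.

Fixpoint iter_deriv (V W : normedModType R) (f : V -> W) (vs : seq V) : V -> W :=
  match vs with
  | [::] => f
  | v :: vs' => fun x => 'D_v (iter_deriv f vs') x
  end.

Definition smooth_on (V W : normedModType R) (U : set V) (f : V -> W) :=
  forall (vs : seq V) (x : V), U x -> differentiable (iter_deriv f vs) x.

Definition smooth (V W : normedModType R) (f : V -> W) := smooth_on setT f.

Definition local_diffeo (n : nat) (f : 'rV[R]_n -> 'rV[R]_n) :=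
  smooth f /\
  forall k, exists (U W : set 'rV[R]_n) (g : 'rV[R]_n -> 'rV[R]_n),
    [/\ open U /\ open W, U k /\ f @` U = W,
        (forall x, U x -> g (f x) = x), (forall y, W y -> f (g y) = y)
      & smooth_on W g].

Definition vfield (n : nat) := 'rV[R]_n -> 'rV[R]_n.
Definition tvfield (n : nat) := R -> vfield n.

Definition tsmooth (n : nat) (X : tvfield n) :=
  smooth (fun z : R * 'rV[R]_n => X z.1 z.2).

Definition lie_bracket (n : nat) (Y Z : vfield n) : vfield n :=
  fun x => 'D_(Y x) Z x - 'D_(Z x) Y x.

Definition lie_closed (n : nat) (S : set (vfield n)) :=
  [/\ S (fun _ => 0),
      (forall (a b : R) Y Z, S Y -> S Z -> S (fun x => a *: Y x + b *: Z x))
    & (forall Y Z, S Y -> S Z -> S (lie_bracket Y Z))].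

Definition VLie (n : nat) (X : tvfield n) : set (vfield n) :=
  fun Y => forall S : set (vfield n),
    lie_closed S -> (forall t, S (X t)) -> S Y.

Definition lie_system (n : nat) (X : tvfield n) :=
  exists (d : nat) (B : 'I_d -> vfield n),
    (forall i, VLie X (B i)) /\
    forall Y, VLie X Y -> exists c : 'I_d -> R,
      forall x, Y x = \sum_(i < d) c i *: B i x.

Definition solution_on (n : nat) (X : tvfield n) (a b : R)
    (x : R -> 'rV[R]_n) :=
  forall t, a < t < b -> derivable x t 1 /\ 'D_1 x t = X t (x t).

(* product space R^{n_1} x ... x R^{n_m}, as row vectors of size sum n_a *)
Definition prod_dim (m : nat) (ns : 'I_m -> nat) := (\sum_(a < m) ns a)%N.

Definition direct_product (m : nat) (ns : 'I_m -> nat)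
    (Xs : forall a : 'I_m, tvfield (ns a)) : tvfield (prod_dim ns) :=
  fun t p => \mxrow_(a < m) Xs a t (submxrow p a).

Definition mixed_superposition_rule (n0 m : nat) (ns : 'I_m -> nat)
    (X : tvfield n0) (Xs : forall a : 'I_m, tvfield (ns a))
    (Phi : 'rV[R]_(prod_dim ns) -> 'rV[R]_n0 -> 'rV[R]_n0) :=
  smooth (fun z : 'rV[R]_(prod_dim ns) * 'rV[R]_n0 => Phi z.1 z.2) /\
  exists G : set 'rV[R]_(prod_dim ns),
    [/\ open G, dense G,
        (forall p, G p -> local_diffeo (Phi p))
      & forall (a b : R) (p : R -> 'rV[R]_(prod_dim ns)),
          a < b -> solution_on (direct_product Xs) a b p ->
          (forall t, a < t < b -> G (p t)) ->
          (forall k, solution_on X a b (fun t => Phi (p t) k)) /\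
          (forall (x : R -> 'rV[R]_n0) (t0 : R) (k : 'rV[R]_n0),
             solution_on X a b x -> a < t0 < b -> x t0 = Phi (p t0) k ->
             forall t, a < t < b -> x t = Phi (p t) k)].

Definition f_related (n n' : nat) (f : 'rV[R]_n -> 'rV[R]_n')
    (Z : vfield n) (Y : vfield n') :=
  forall p, 'D_(Z p) f p = Y (f p).

End Defs.

(* Main.v *)
(** The point is that [X^t] is [Phi_k]-related to the direct product [Xhat^t].  Through every
    point of the generic open set [G] passes, at time [t], an integral curve of [Xhat]
    (Picard-Lindelof) that stays in [G] for a short time; [Phi_k] maps it to an integral curve of
    [X], and differentiating gives the relation on [G], hence everywhere since [G] is dense.
    Being [Phi_k]-related is compatible with linear combinations and, second derivatives being
    symmetric, with brackets, so it propagates to the whole of [V^Xhat] and [V^X]; the related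
    field is unique because [Phi_k] has dense range.  Finally [V^Xhat] lies in the direct sum of
    the finite-dimensional algebras [V^{X_(a)}]. *)
Require Import Defs.
From HB Require Import structures.
From mathcomp Require Import all_boot all_order all_algebra.
From mathcomp Require Import all_classical all_reals all_analysis.
From mathcomp Require Import ring lra.
Import Order.TTheory GRing.Theory Num.Theory.
Import numFieldNormedType.Exports.
Local Open Scope classical_set_scope.
Local Open Scope ring_scope.

Set Implicit Arguments.
Unset Strict Implicit.
Unset Printing Implicit Defensive.

(** * Smooth maps between normed spaces and their directional derivatives *)

Section Calculus.
Context {R : realType}.
Implicit Types U V W : normedModType R.

Lemma derive_compE U V W (f : U -> V) (g : V -> W) (x v : U) :
  differentiable f x -> differentiable g (f x) ->
  'D_v (g \o f) x = 'D_('D_v f x) g (f x).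
Proof.
move=> df dg; rewrite !deriveE//; first by rewrite diff_comp.
exact: differentiable_comp.
Qed.

Lemma iter_deriv_rcons V W (f : V -> W) vs v :
  iter_deriv f (rcons vs v) = iter_deriv ('D_v f) vs.
Proof. by elim: vs => //= w vs ->. Qed.

Lemma smooth_differentiable V W (f : V -> W) x : smooth f -> differentiable f x.
Proof. by move=> /(_ [::] x); apply. Qed.

Lemma smooth_derive V W (f : V -> W) v : smooth f -> smooth ('D_v f).
Proof. by move=> sf vs x _; rewrite -iter_deriv_rcons; exact: sf. Qed.

Lemma smooth_derivable V W (f : V -> W) x v : smooth f -> derivable f x v.
Proof. by move=> sf; exact/diff_derivable/smooth_differentiable. Qed.

Lemma smooth_continuous V W (f : V -> W) : smooth f -> continuous f.
Proof. by move=> sf x; exact/differentiable_continuous/smooth_differentiable. Qed.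

(** Coinduction principle behind the closure properties below: it suffices to find a class of
    differentiable maps stable under every ['D_v]. The induction peels off the last vector of the
    list, which is the direction of the innermost derivative. *)
Lemma smooth_coind V W (P : (V -> W) -> Prop) :
  (forall f x, P f -> differentiable f x) ->
  (forall f v, P f -> P ('D_v f)) -> forall f, P f -> smooth f.
Proof.
move=> Pd PD f Pf vs; elim/last_ind: vs f Pf => [|vs v IH] f Pf x _.
  exact: Pd.
by rewrite iter_deriv_rcons; exact: IH (PD _ _ Pf) x I.
Qed.

Lemma smooth_cst V W (w : W) : smooth (fun _ : V => w).
Proof.
pose P (f : V -> W) := exists w, f = cst w.
apply: (@smooth_coind _ _ P); last by exists w.
- by move=> _ x [u ->]; exact: differentiable_cst.
- by move=> _ v [u ->]; exists 0; apply/funext => x; rewrite derive_cst.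
Qed.

Lemma smooth_lin_comb V W (a b : R) (f g : V -> W) :
  smooth f -> smooth g -> smooth (fun x => a *: f x + b *: g x).
Proof.
move=> sf sg.
pose P (h : V -> W) := exists f g, [/\ smooth f, smooth g & h = a *: f + b *: g].
have Pd h x : P h -> differentiable h x.
  move=> [u [v [su sv ->]]]; apply: differentiableD.
    exact/differentiableZ/smooth_differentiable.
  exact/differentiableZ/smooth_differentiable.
apply: (@smooth_coind _ _ P Pd); last by exists f, g; split.
move=> _ w [u [v [su sv ->]]]; exists ('D_w u), ('D_w v); split.
- exact: smooth_derive.
- exact: smooth_derive.
- apply/funext => x; rewrite deriveD; [|exact/derivableZ/smooth_derivable..].
  by rewrite !deriveZ; try exact: smooth_derivable.
Qed.

Lemma smoothD V W (f g : V -> W) : smooth f -> smooth g -> smooth (fun x => f x + g x).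
Proof.
move=> sf sg; have := @smooth_lin_comb _ _ 1 1 _ _ sf sg.
by congr smooth; apply/funext => x; rewrite !scale1r.
Qed.

Lemma smoothB V W (f g : V -> W) : smooth f -> smooth g -> smooth (fun x => f x - g x).
Proof.
move=> sf sg; have := @smooth_lin_comb _ _ 1 (-1) _ _ sf sg.
by congr smooth; apply/funext => x; rewrite scale1r scaleN1r.
Qed.

Lemma smooth_sum V W n (f : 'I_n -> V -> W) :
  (forall i, smooth (f i)) -> smooth (fun x => \sum_(i < n) f i x).
Proof.
move=> sf; elim: n f sf => [|n IH] f sf.
  under eq_fun do rewrite big_ord0; exact: smooth_cst.
under eq_fun do rewrite big_ord_recr/=; apply: smoothD => //; exact: IH.
Qed.

(* [D_v] does not preserve the products of two smooth functions, but it preserves their sums. *)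
Inductive product_closure V : (V -> R) -> Prop :=
| product_closureM (f g : V -> R) : smooth f -> smooth g -> product_closure (fun x => f x * g x)
| product_closureD (f g : V -> R) :
    product_closure f -> product_closure g -> product_closure (fun x => f x + g x).

Lemma smoothM V (f g : V -> R) : smooth f -> smooth g -> smooth (fun x => f x * g x).
Proof.
move=> sf sg.
have Pd (h : V -> R) x : product_closure h -> differentiable h x.
  elim=> {h} [u v su sv|u v _ du _ dv].
    by apply: differentiableM; exact: smooth_differentiable.
  exact: differentiableD.
apply: (@smooth_coind _ _ (@product_closure V) Pd); last by constructor.
move=> h w; elim=> {h} [u v su sv|u v pu IHu pv IHv].
- have -> : 'D_w (fun x => u x * v x) = fun x => u x * 'D_w v x + v x * 'D_w u x.
    by apply/funext => x; rewrite deriveM//; exact: smooth_derivable.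
  by constructor; constructor => //; exact: smooth_derive.
- have -> : 'D_w (fun x => u x + v x) = fun x => 'D_w u x + 'D_w v x.
    by apply/funext => x; rewrite deriveD//; exact/diff_derivable/Pd.
  by constructor.
Qed.

(** The derivative of [A] does not depend on the base point, so ['D_v (f \o A)] is
    ['D_(L v) f \o A], again a smooth map composed with [A]. *)
Lemma smooth_comp_affine U V W (A : U -> V) (L : U -> V) (f : V -> W) :
  (forall x, differentiable A x) -> (forall x v, 'D_v A x = L v) ->
  smooth f -> smooth (fun x => f (A x)).
Proof.
move=> dA DA sf.
pose P (h : U -> W) := exists2 f, smooth f & h = f \o A.
apply: (@smooth_coind _ _ P); last by exists f.
- move=> _ x [g sg ->]; apply: differentiable_comp => //.
  exact: smooth_differentiable.
- move=> _ v [g sg ->]; exists ('D_(L v) g); first exact: smooth_derive.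
  apply/funext => x; rewrite derive_compE ?DA//; exact: smooth_differentiable.
Qed.

Lemma differentiable_rVP V n (f : V -> 'rV[R]_n) x :
  differentiable f x <-> forall j, differentiable (fun y => f y 0 j) x.
Proof.
split=> [df j|df].
  apply: (@differentiable_comp _ _ _ _ f (fun M : 'rV[R]_n => M 0 j)) => //.
  exact: differentiable_coord.
have -> : f = \sum_(j < n) (fun y => f y 0 j *: (delta_mx 0 j : 'rV[R]_n)).
  by apply/funext => y; rewrite fct_sumE -row_sum_delta.
by apply: differentiable_sum => j; exact: differentiableZl.
Qed.

Lemma derive_rV V n (f : V -> 'rV[R]_n) x v j : derivable f x v ->
  ('D_v f x) 0 j = 'D_v (fun y => f y 0 j) x.
Proof. by move=> df; rewrite derive_mx// mxE. Qed.

Lemma smooth_rVP V n (f : V -> 'rV[R]_n) :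
  smooth f <-> forall j, smooth (fun x => f x 0 j).
Proof.
split=> [sf j|sf].
  pose P (h : V -> R) := exists2 f : V -> 'rV[R]_n, smooth f & h = (fun x => f x 0 j).
  apply: (@smooth_coind _ _ P); last by exists f.
    by move=> _ x [g sg ->]; exact/((differentiable_rVP g x).1)/smooth_differentiable.
  move=> _ v [g sg ->]; exists ('D_v g); first exact: smooth_derive.
  by apply/funext => x; rewrite derive_rV//; exact: smooth_derivable.
pose P (h : V -> 'rV[R]_n) := forall j, smooth (fun x => h x 0 j).
have Pd g x : P g -> differentiable g x.
  by move=> Pg; apply/differentiable_rVP => j; exact: smooth_differentiable.
apply: (@smooth_coind _ _ P Pd) => [g v Pg j|//].
rewrite (_ : (fun _ => _) = 'D_v (fun y => g y 0 j)); first exact: smooth_derive.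
by apply/funext => x; rewrite derive_rV//; exact/diff_derivable/Pd.
Qed.

Lemma derive_lin_comb V W (a b : R) (f : V -> W) x v w : differentiable f x ->
  'D_(a *: v + b *: w) f x = a *: 'D_v f x + b *: 'D_w f x.
Proof. by move=> df; rewrite !deriveE// linearD !linearZ. Qed.

Lemma derive_rV_basis W n (f : 'rV[R]_n -> W) x v : differentiable f x ->
  'D_v f x = \sum_(j < n) v 0 j *: 'D_(delta_mx 0 j) f x.
Proof.
move=> df; rewrite deriveE// {1}(row_sum_delta v) linear_sum.
by apply: eq_bigr => j _; rewrite linearZ deriveE.
Qed.

(** In coordinates this is a sum of products of components of [Z] with partial derivatives of
    [f]. *)
Lemma smooth_derive_along n m (Z : vfield R n) (f : 'rV[R]_n -> 'rV[R]_m) :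
  smooth Z -> smooth f -> smooth (fun x => 'D_(Z x) f x).
Proof.
move=> sZ sf; apply/smooth_rVP => i.
have sfj j : smooth ('D_(delta_mx 0 j) f) by exact: smooth_derive.
rewrite (_ : (fun _ => _) = fun x => \sum_(j < n) Z x 0 j * 'D_(delta_mx 0 j) f x 0 i).
  apply: smooth_sum => j; apply: smoothM; first exact: ((smooth_rVP Z).1 sZ).
  exact: ((smooth_rVP _).1 (sfj j)).
apply/funext => x; rewrite derive_rV_basis; last exact: smooth_differentiable.
by rewrite summxE; apply: eq_bigr => j _; rewrite mxE.
Qed.

(** Leibniz rule in the expansion along the canonical basis: the terms where the coefficients of [Z]
    are differentiated are reassembled, the second-order ones stay expanded until symmetry is
    available. *)
Lemma derive_derive_along n m (Z : vfield R n) (f : 'rV[R]_n -> 'rV[R]_m) x v :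
  smooth Z -> smooth f ->
  'D_v (fun y => 'D_(Z y) f y) x =
  'D_('D_v Z x) f x + \sum_(j < n) Z x 0 j *: 'D_v ('D_(delta_mx 0 j) f) x.
Proof.
move=> sZ sf; apply/rowP => i; rewrite mxE summxE.
rewrite derive_rV; last exact/smooth_derivable/smooth_derive_along.
have sfj j : smooth ('D_(delta_mx 0 j) f) by exact: smooth_derive.
have sZj j : smooth (fun y => Z y 0 j) by exact: ((smooth_rVP Z).1 sZ).
have sfji j : smooth (fun y => 'D_(delta_mx 0 j) f y 0 i).
  exact: ((smooth_rVP _).1 (sfj j)).
rewrite (_ : (fun _ => _) =
    \sum_(j < n) (fun y => Z y 0 j * 'D_(delta_mx 0 j) f y 0 i)); last first.
  apply/funext => y; rewrite derive_rV_basis; last exact: smooth_differentiable.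
  by rewrite summxE fct_sumE; apply: eq_bigr => j _; rewrite mxE.
rewrite derive_sum; last by move=> j; exact/smooth_derivable/smoothM.
rewrite (derive_rV_basis _ (smooth_differentiable x sf)) summxE -big_split/=.
apply: eq_bigr => j _; rewrite deriveM; try exact: smooth_derivable.
rewrite !mxE -!derive_rV; [|exact: smooth_derivable..].
by rewrite addrC; congr (_ + _); exact: mulrC.
Qed.

(** * Symmetry of second derivatives, and identities extended from dense sets *)

Lemma mvt_line V (f : V -> R) x v (h : R) : 0 <= h ->
  (forall y, differentiable f y) ->
  exists2 s, 0 <= s <= h & f (x + h *: v) - f x = h * 'D_v f (x + s *: v).
Proof.
move=> h0 df.
have dl s : is_diff s (fun s : R => x + s *: v) (fun s => s *: v).
  by apply: is_diff_eq; rewrite add0r.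
have dg s : differentiable (fun s : R => f (x + s *: v)) s.
  by apply: (@differentiable_comp _ _ _ _ (fun s : R => x + s *: v) f).
have Dg s : 'D_1 (fun s : R => f (x + s *: v)) s = 'D_v f (x + s *: v).
  rewrite (@derive_compE _ _ _ (fun s : R => x + s *: v) f)//; last first.
  by congr ('D_ _ f _); rewrite deriveE// diff_val scale1r.
have gD s : s \in `]0, h[ ->
    is_derive s 1 (fun s : R => f (x + s *: v)) ('D_v f (x + s *: v)).
  by move=> _; apply: DeriveDef => //; exact/diff_derivable.
have gc : {within `[0, h], continuous (fun s : R => f (x + s *: v))}.
  by apply: continuous_subspaceT => s; exact/differentiable_continuous.
have [s] := MVT_segment h0 gD gc.
rewrite in_itv/= scale0r addr0 subr0 => s0h ->; exists s => //.
by rewrite mulrC.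
Qed.

(** The mean value theorem is applied twice: along [v] to the increment of [f] by [h *: w], then
    along [w] to ['D_v f]. *)
Lemma second_difference V (f : V -> R) x v w (h : R) : 0 <= h -> smooth f ->
  exists s t, [/\ 0 <= s <= h, 0 <= t <= h &
    f (x + h *: v + h *: w) - f (x + h *: v) - (f (x + h *: w) - f x) =
    h * (h * 'D_w ('D_v f) (x + s *: v + t *: w))].
Proof.
move=> h0 sf.
have idd y : is_diff y (fun y : V => y + h *: w) (fun y => y).
  by apply: is_diff_eq; rewrite addr0.
have dfw y : differentiable (fun y => f (y + h *: w)) y.
  apply: (@differentiable_comp _ _ _ _ (fun y => y + h *: w) f) => //.
  exact: smooth_differentiable.
have df y : differentiable f y by exact: smooth_differentiable.
have dg y : differentiable (fun y => f (y + h *: w) - f y) y.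
  exact: differentiableB.
have [s s0h E1] := @mvt_line _ (fun y => f (y + h *: w) - f y) x v h h0 dg.
have DVf y : differentiable ('D_v f) y by exact/smooth_differentiable/smooth_derive.
have [t t0h E2] := @mvt_line _ ('D_v f) (x + s *: v) w h h0 DVf.
exists s, t; split => //.
rewrite E1 -E2 deriveB; [|exact/diff_derivable..].
congr (_ * (_ - _)).
rewrite (@derive_compE _ _ _ (fun y => y + h *: w) f)//.
by congr ('D_ _ f _); rewrite deriveE// diff_val.
Qed.

Lemma le_dist_halves (p q c d e : R) :
  `|p - c| < e / 2 -> `|q - d| < e / 2 -> c = d -> `|p - q| <= e.
Proof.
move=> pc qd cd; apply: (le_trans (ler_distD c p q)); rewrite (splitr e).
by apply: lerD; apply: ltW => //; rewrite distrC cd.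
Qed.

(* Both mixed derivatives are values near [x] of the same second difference. *)
Lemma derive_comm_real V (f : V -> R) x v w : smooth f ->
  'D_v ('D_w f) x = 'D_w ('D_v f) x.
Proof.
move=> sf; apply/eqP; rewrite -subr_eq0 -normr_le0; apply/ler_addgt0Pl => e e0.
rewrite addr0.
have c1 : continuous ('D_v ('D_w f)).
  exact/smooth_continuous/smooth_derive/smooth_derive.
have c2 : continuous ('D_w ('D_v f)).
  exact/smooth_continuous/smooth_derive/smooth_derive.
have e20 : 0 < e / 2 by rewrite divr_gt0.
have N1 : \forall y \near x, `|'D_v ('D_w f) x - 'D_v ('D_w f) y| < e / 2.
  by have /cvgrPdist_lt := c1 x; apply.
have N2 : \forall y \near x, `|'D_w ('D_v f) x - 'D_w ('D_v f) y| < e / 2.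
  by have /cvgrPdist_lt := c2 x; apply.
have [r /= r0 Hr] := (nbhs_ballP _ _).1 (@filterI _ (nbhs x) _ _ _ N1 N2).
(* The summand 1 keeps [K] positive when [v] and [w] vanish; with [h * K = r / 2] all intermediate
   points stay in the ball. *)
pose K := `|v| + `|w| + 1.
have K0 : 0 < K by rewrite ltr_wpDl// addr_ge0.
pose h := r / (2 * K).
have h0 : 0 < h by rewrite divr_gt0// mulr_gt0.
have inball s t : 0 <= s <= h -> 0 <= t <= h -> ball x r (x + s *: v + t *: w).
  move=> /andP[s0 sh] /andP[t0 th]; rewrite -ball_normE/= -addrA opprD addrA subrr sub0r normrN.
  rewrite (le_lt_trans (ler_normD _ _))// !normrZ !ger0_norm//.
  apply: (@le_lt_trans _ _ (h * K)).
    rewrite /K mulrDr mulr1 mulrDr; apply: ler_wpDr; first exact: ltW.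
    by apply: lerD; apply: ler_wpM2r.
  rewrite /h invfM mulrA -mulrA mulVf ?gt_eqF// mulr1 ltr_pdivrMr//.
  by rewrite mulr_natr mulr2n ltrDl.
have [s [t [s0 t0 E]]] := @second_difference _ f x v w h (ltW h0) sf.
have [t' [s' [t'0 s'0 E']]] := @second_difference _ f x w v h (ltW h0) sf.
have [_ B2] := Hr _ (inball _ _ s0 t0).
have ib : ball x r (x + t' *: w + s' *: v) by rewrite addrAC; exact: inball.
have [B1 _] := Hr _ ib.
have EE : 'D_v ('D_w f) (x + t' *: w + s' *: v) = 'D_w ('D_v f) (x + s *: v + t *: w).
  have hn0 : h != 0 by rewrite gt_eqF.
  have aux (p q c d : R) : c = h * (h * q) -> d = h * (h * p) -> c = d -> p = q.
    by move=> -> -> /(mulfI hn0)/(mulfI hn0).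
  apply: (aux _ _ _ _ E E').
  have -> : x + h *: v + h *: w = x + h *: w + h *: v by rewrite addrAC.
  ring.
exact: (le_dist_halves B1 B2 EE).
Qed.

Lemma derive_comm V n (f : V -> 'rV[R]_n) x v w : smooth f ->
  'D_v ('D_w f) x = 'D_w ('D_v f) x.
Proof.
move=> sf; apply/rowP => j.
have E u : (fun y => ('D_u f y) 0 j) = 'D_u (fun y => f y 0 j).
  by apply/funext => y; rewrite derive_rV//; exact: smooth_derivable.
have D u u' : ('D_u ('D_u' f) x) 0 j = 'D_u ('D_u' (fun y => f y 0 j)) x.
  rewrite -E; apply: (@derive_rV _ _ ('D_u' f)).
  exact/smooth_derivable/smooth_derive.
have sfj : smooth (fun y => f y 0 j) by exact: ((smooth_rVP f).1 sf).
exact: (etrans (D v w) (etrans (derive_comm_real x v w sfj) (esym (D w v)))).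
Qed.

(** The points where [f] and [g] differ form an open set, which would meet [D] if it were
    nonempty. *)
Lemma dense_eq_continuous (T : topologicalType) n (f g : T -> 'rV[R]_n) (D : set T) :
  dense D -> continuous f -> continuous g -> (forall x, D x -> f x = g x) -> f = g.
Proof.
move=> dD cf cg fg; apply/funext => x; apply: contrapT => /eqP fgx.
have op : open [set y | `|f y - g y| != 0].
  apply: (@open_comp _ _ (fun y => `|f y - g y|) [set z : R | z != 0]).
    by move=> y _; apply: cvg_norm; apply: cvgB; [exact: cf|exact: cg].
  exact: open_neq.
have [|y [/= fgy Dy]] := dD _ _ op; first by exists x; rewrite /= normr_eq0 subr_eq0.
by move: fgy; rewrite fg// subrr normr0 eqxx.
Qed.
End Calculus.

(** * Antiderivatives, mean value estimates and geometric limits for curves *)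

Section Picard.
Context {R : realType}.

(** Row vectors carry the maximum norm; the sign condition on [e] covers the empty maximum when [n]
    is 0. *)
Lemma le_norm_rVP n (v : 'rV[R]_n) e : 0 <= e ->
  `|v| <= e <-> forall j, `|v 0 j| <= e.
Proof.
move=> e0; split=> [ve j|ve].
  apply: le_trans ve; rewrite [leRHS]/Num.Def.normr/= mx_normrE.
  exact: (le_bigmax _ _ (ord0, j)).
rewrite /Num.Def.normr/= mx_normrE (bigmax_le _ e0)//= => -[i j] _ /=.
by rewrite [i]ord1.
Qed.

Lemma antiderivative_real (f : R -> R) a b : a < b -> continuous f ->
  exists g : R -> R, forall t, a < t < b -> derivable g t 1 /\ 'D_1 g t = f t.
Proof.
move=> ab cf.
exists (fun x => \int[lebesgue_measure]_(t in `[a, x]) f t)%R => t /andP[at_ tb].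
have fi : lebesgue_measure.-integrable `[a, b] (EFin \o f).
  apply: continuous_compact_integrable; first exact: segment_compact.
  exact: continuous_subspaceT.
have [d1 d2] := @continuous_FTC1_closed R f a t b tb fi at_ (cf t).
by split=> //; rewrite -derive1E.
Qed.

Lemma antiderivative_rV n (f : R -> 'rV[R]_n) a b t0 p0 : a < t0 < b -> continuous f ->
  exists g : R -> 'rV[R]_n, g t0 = p0 /\
    forall t, a < t < b -> derivable g t 1 /\ 'D_1 g t = f t.
Proof.
move=> /andP[at0 t0b] cf.
have cfj j : continuous (fun t => f t 0 j).
  move=> t; apply: (@continuous_comp _ _ _ f (fun M : 'rV[R]_n => M 0 j)).
    exact: cf.
  exact: coord_continuous.
have /choice[G HG] : forall j, exists g : R -> R,
    forall t, a < t < b -> derivable g t 1 /\ 'D_1 g t = f t 0 j.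
  by move=> j; apply: antiderivative_real => //; exact: lt_trans t0b.
exists (fun t => \row_j (G j t - G j t0 + p0 0 j)); split.
  by apply/rowP => j; rewrite !mxE subrr add0r.
move=> t tab.
have dj j : is_derive t 1 (fun s => (\row_j (G j s - G j t0 + p0 0 j)) 0 j) (f t 0 j).
  have [d D] := HG j _ tab.
  rewrite (_ : (fun _ => _) = fun s => G j s + (- G j t0 + p0 0 j)); last first.
    by apply/funext => s; rewrite mxE addrA.
  have : is_derive t 1 (fun s => G j s + (- G j t0 + p0 0 j)) ('D_1 (G j) t + 0).
    by apply: is_deriveD; exact/derivableP.
  by rewrite addr0 D.
have dd : derivable (fun t => \row_j (G j t - G j t0 + p0 0 j)) t 1.
  by apply/derivable_mxP => i j; rewrite [i]ord1; exact: ex_derive.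
split=> //; rewrite derive_mx//; apply/rowP => j; rewrite mxE.
exact: derive_val.
Qed.

(** The mean value theorem is applied to each coordinate; the maximum norm lets the same [K] serve
    for the vector. *)
Lemma mean_value_bound n (g : R -> 'rV[R]_n) a b K s t :
  (forall u, a < u < b -> derivable g u 1 /\ `|'D_1 g u| <= K) ->
  a < s < b -> a < t < b -> `|g t - g s| <= K * `|t - s|.
Proof.
move=> dg sab tab.
have K0 : 0 <= K by have [_] := dg _ sab; exact: le_trans.
wlog st : s t sab tab / s <= t.
  move=> H; have [st|/ltW ts] := leP s t; first exact: H.
  by rewrite distrC (distrC t); exact: H.
apply/le_norm_rVP => [|j]; first by rewrite mulr_ge0.
have sub u : s <= u <= t -> a < u < b.
  move=> /andP[su ut]; move: sab tab => /andP[as_ _] /andP[_ tb].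
  by rewrite (lt_le_trans as_ su) (le_lt_trans ut tb).
have dj u : s <= u <= t -> is_derive u 1 (fun x => g x 0 j) (('D_1 g u) 0 j).
  move=> /sub/dg[d _]; apply: DeriveDef; first exact/(derivable_mxP g u 1).1.
  by rewrite derive_rV.
have dio u : u \in `]s, t[ -> is_derive u 1 (fun x => g x 0 j) (('D_1 g u) 0 j).
  by rewrite in_itv/= => /andP[su ut]; apply: dj; rewrite !ltW.
have cg : {within `[s, t], continuous (fun x => g x 0 j)}.
  apply: derivable_within_continuous => u; rewrite in_itv/= => uin.
  by have [] := dj u uin.
have [u] := MVT_segment st dio cg.
rewrite in_itv/= => /sub/dg[_ Du] E; rewrite !mxE E normrM ler_wpM2r//.
exact: ((le_norm_rVP _ K0).1 Du).
Qed.

(** For [a <= b], the continuous retraction of the line onto the segment from [a] to [b]. *)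
Definition clamp (a b t : R) := Num.max a (Num.min t b).

Lemma clamp_bounds a b t : a <= b -> a <= clamp a b t <= b.
Proof.
move=> ab; rewrite /clamp le_max lexx/= ge_max ab/=.
by rewrite ge_min lexx orbT.
Qed.

Lemma clamp_id a b t : a <= t <= b -> clamp a b t = t.
Proof. by move=> /andP[ta tb]; rewrite /clamp min_l// max_r. Qed.

Lemma clamp_continuous a b : continuous (clamp a b).
Proof.
move=> t; apply: (@continuous_max _ _ (fun=> a) (fun t => Num.min t b)).
  exact: cvg_cst.
by apply: (@continuous_min _ _ id (fun=> b)); [exact: cvg_id|exact: cvg_cst].
Qed.

(* The limit is the supremum of the increasing sequence [u n - 2 C / 2 ^ n]. *)
Lemma geometric_limit (u : nat -> R) C :
  (forall n, `|u n.+1 - u n| <= C / 2 ^+ n) ->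
  exists l, forall n, `|l - u n| <= 2 * C / 2 ^+ n.
Proof.
move=> uC.
pose lo n := u n - 2 * C / 2 ^+ n; pose hi n := u n + 2 * C / 2 ^+ n.
have step n : lo n <= lo n.+1 /\ hi n.+1 <= hi n.
  have := uC n; rewrite /lo /hi exprS invfM !mulrA.
  set q := (2 ^+ n)^-1; rewrite ler_norml => /andP[h1 h2].
  have -> : 2 * C / 2 * q = C * q by field.
  by split; lra.
have lohi n : lo n <= hi n.
  have := le_trans (normr_ge0 _) (uC n); rewrite /lo /hi -mulrA; lra.
have lom m n : (m <= n)%N -> lo m <= lo n.
  move: m n; apply: (homo_leq (r := fun x y => x <= y)) => // [y x z|n].
    exact: le_trans.
  by have [] := step n.
have him m n : (m <= n)%N -> hi n <= hi m.
  move: m n; apply: (homo_leq (r := fun x y => y <= x)) => // [y x z xy yz|n].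
    exact: le_trans yz xy.
  by have [] := step n.
have lohi2 m n : lo m <= hi n.
  apply: le_trans (lom _ _ (leq_maxl m n)) _.
  exact: le_trans (lohi _) (him _ _ (leq_maxr m n)).
have hs : has_sup (range lo).
  by split; [exists (lo 0), 0|exists (hi 0) => _ [m _ <-]].
exists (sup (range lo)) => n; rewrite ler_distl.
apply/andP; split.
  by apply: ub_le_sup; [case: hs|exists n].
by apply: ge_sup; [exists (lo 0), 0|move=> _ [m _ <-]; exact: lohi2].
Qed.

Lemma geometric_limit_rV d (u : nat -> 'rV[R]_d) C :
  (forall n, `|u n.+1 - u n| <= C / 2 ^+ n) ->
  exists l, forall n, `|l - u n| <= 2 * C / 2 ^+ n.
Proof.
move=> uC.
have C0 n : 0 <= C / 2 ^+ n by exact: le_trans (uC n).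
have /choice[l Hl] : forall j, exists l, forall n, `|l - u n 0 j| <= 2 * C / 2 ^+ n.
  move=> j; apply: geometric_limit => n.
  by have /le_norm_rVP -/(_ (C0 n) j) := uC n; rewrite !mxE.
exists (\row_j l j) => n; apply/le_norm_rVP => [|j]; last by rewrite !mxE.
by rewrite -mulrA mulr_ge0.
Qed.

Lemma geometric_small (C e : R) : 0 < e -> exists n, C / 2 ^+ n < e.
Proof.
move=> e0; have [C0|C0] := leP C 0.
  by exists 0; rewrite expr0 divr1 (le_lt_trans C0).
(* For this [n] one has [C / e < n < 2 ^+ n]. *)
exists (Num.truncn (C / e)).+1; rewrite ltr_pdivrMr ?exprn_gt0//.
rewrite mulrC -ltr_pdivrMr//; apply: lt_trans (truncnS_gt _) _.
by rewrite -natrX ltr_nat ltn_expl.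
Qed.
End Picard.

(** * Local existence of integral curves *)

Section PicardLindelof.
Context {R : realType}.

(** Contraction argument: [d * M <= r] keeps the iterates within distance [r] of [p0], and
    [d * L <= 1 / 2] makes the Picard operator halve uniform distances, so successive iterates
    differ by at most [r / 2 ^+ k]. *)
Lemma picard_iteration n (F : R * 'rV[R]_n -> 'rV[R]_n) t0 p0 (r d M L : R) :
  0 < d -> 0 <= r -> 0 <= M -> 0 <= L -> d * M <= r -> d * L <= 1 / 2 -> continuous F ->
  (forall t x, `|t - t0| <= d -> `|x - p0| <= r -> `|F (t, x)| <= M) ->
  (forall t x y, `|t - t0| <= d -> `|x - p0| <= r -> `|y - p0| <= r ->
     `|F (t, x) - F (t, y)| <= L * `|x - y|) ->
  exists p : R -> 'rV[R]_n, p t0 = p0 /\ forall t, t0 - d < t < t0 + d ->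
    [/\ derivable p t 1, 'D_1 p t = F (t, p t) & `|p t - p0| <= r].
Proof.
move=> d0 r0 M0 L0 dMr dL cF FM FL.
set a := t0 - d; set b := t0 + d; pose c := clamp a b.
(* Clamping the time makes every Picard iterate a globally defined continuous curve. *)
have ab : a <= b by rewrite /a /b; lra.
have cab t : a <= c t <= b by exact: clamp_bounds.
have cd t : `|c t - t0| <= d.
  by rewrite ler_distl; have := cab t; rewrite /a /b; case/andP => -> ->.
(* The margin 1 puts the clamped times, endpoints included, inside an open interval on which the
   antiderivatives are differentiable. *)
have cin t : a - 1 < c t < b + 1 by have /andP[] := cab t; lra.
have t0in : a - 1 < t0 < b + 1 by rewrite /a /b; lra.
have ct0 : c t0 = t0 by apply: clamp_id; rewrite /a /b; lra.
pose adm (u : R -> 'rV[R]_n) := continuous u /\ forall t, `|u t - p0| <= r.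
(* Admissibility is a premise inside the existential so that choice gives a total operator; its
   value on other curves is arbitrary. *)
have /choice[G HG] : forall u : R -> 'rV[R]_n, exists g : R -> 'rV[R]_n,
    adm u -> g t0 = p0 /\
      forall t, a - 1 < t < b + 1 -> derivable g t 1 /\ 'D_1 g t = F (c t, u t).
  move=> u; have [[cu ur]|nadm] := pselect (adm u); last by exists u.
  have cf : continuous (fun t => F (c t, u t)).
    move=> t; apply: (@continuous_comp _ _ _ (fun t => (c t, u t)) F); last exact: cF.
    apply: (@cvg_pair _ _ _ (nbhs t) (nbhs (c t)) (nbhs (u t))).
      exact: clamp_continuous.
    exact: cu.
  by have [g Hg] := antiderivative_rV p0 t0in cf; exists g.
(* On admissible curves this is the Picard operator: [p0] plus the integral of [F (c s, u s)] for
   [s] from [t0] to [c t]. *)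
pose T u t := G u (c t).
have admT u : adm u -> adm (T u).
  move=> au; have [g0 Dg] := HG u au; split=> t.
    apply: (@continuous_comp _ _ _ c (G u)); first exact: clamp_continuous.
    by apply/differentiable_continuous/derivable1_diffP; have [] := Dg _ (cin t).
  have : `|G u (c t) - G u t0| <= M * `|c t - t0|.
    apply: (@mean_value_bound R n (G u) (a - 1) (b + 1)) => // s /Dg[ds ->].
    by split=> //; apply: FM => //; have [] := au.
  rewrite g0 => /le_trans; apply; apply: le_trans dMr.
  by rewrite mulrC ler_wpM2r.
have contr u v e : adm u -> adm v -> (forall t, `|u t - v t| <= e) ->
    forall t, `|T u t - T v t| <= e / 2.
  move=> au av uve t; have [g0 Dg] := HG u au; have [h0 Dh] := HG v av.
  have e0 : 0 <= e by exact: le_trans (uve t0).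
  have : `|(G u (c t) - G v (c t)) - (G u t0 - G v t0)| <= L * e * `|c t - t0|.
    apply: (@mean_value_bound R n (fun t => G u t - G v t) (a - 1) (b + 1)) => // s sin.
    have [du Du] := Dg _ sin; have [dv Dv] := Dh _ sin.
    split; first exact: derivableB.
    rewrite deriveB// Du Dv; apply: le_trans (FL _ _ _ _ _ _) _ => //.
    - by have [] := au.
    - by have [] := av.
    - by rewrite ler_wpM2l.
  rewrite g0 h0 subrr subr0 => /le_trans; apply.
  apply: (@le_trans _ _ (L * e * d)); first by rewrite ler_wpM2l// mulr_ge0.
  by rewrite mulrAC mulrC (mulrC L) ler_wpM2l// -(mul1r 2^-1).
pose u_ k := iter k T (fun=> p0).
have admu k : adm (u_ k).
  elim: k => [|k IH]; last exact: admT.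
  split; first by move=> t; exact: cvg_cst.
  by move=> t; rewrite subrr normr0.
have du k t : `|u_ k.+1 t - u_ k t| <= r / 2 ^+ k.
  elim: k t => [|k IH] t.
    by rewrite expr0 divr1; have [_] := admu 1; exact.
  rewrite exprSr invfM mulrA.
  by apply: (contr (u_ k.+1) (u_ k)); [exact: admu|exact: admu|exact: IH].
have /choice[p Hp] : forall t, exists l, forall k, `|l - u_ k t| <= 2 * r / 2 ^+ k.
  by move=> t; apply: geometric_limit_rV => k; exact: du.
(* The bound [Hp] is uniform in time, so [p] is a uniform limit of continuous curves and inherits
   continuity and the distance bound. *)
have admp : adm p.
  split=> t.
    apply/cvgrPdist_le => e e0.
    have e3 : 0 < e / 3 by rewrite divr_gt0.
    have [k Hk] := geometric_small (2 * r) e3.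
    have cu : continuous (u_ k) by have [] := admu k.
    have /cvgrPdist_le/(_ _ e3) N := cu t.
    near=> x.
    have Nx : `|u_ k t - u_ k x| <= e / 3 by near: x.
    have -> : p t - p x = (p t - u_ k t) + (u_ k t - u_ k x) - (p x - u_ k x).
      by rewrite addrA subrK opprB addrA subrK.
    apply: le_trans (ler_normB _ _) _.
    apply: le_trans (lerD (ler_normD _ _) (lexx _)) _.
    have := Hp t k; have := Hp x k; lra.
  apply/ler_addgt0Pl => e e0.
  have [k Hk] := geometric_small (2 * r) e0.
  apply: le_trans (ler_distD (u_ k t) _ _) _.
  apply: lerD; first exact: le_trans (Hp t k) (ltW Hk).
  by have [_] := admu k; exact.
(* Both sides are geometrically close to the iterate [u_ k.+1]: the left by [Hp], the right because
   [T] contracts the distance from [u_ k] to [p]. *)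
have Tp t : p t = T p t.
  apply/eqP; rewrite -subr_eq0 -normr_le0; apply/ler_addgt0Pl => e e0.
  rewrite addr0; have [k Hk] := geometric_small (2 * r) e0.
  apply: le_trans (ler_distD (u_ k.+1 t) _ _) _.
  have h1 := Hp t k.+1.
  have h2 : `|T (u_ k) t - T p t| <= 2 * r / 2 ^+ k / 2.
    by apply: (contr (u_ k) p) => // s; rewrite distrC.
  have E : 2 * r / 2 ^+ k.+1 = 2 * r / 2 ^+ k / 2 by rewrite exprSr invfM mulrA.
  rewrite E in h1; apply: le_trans (lerD h1 h2) _.
  by rewrite -splitr ltW.
have [gp0 Dp] := HG p admp.
exists p; split=> [|t tab]; first by rewrite Tp /T ct0.
have /andP[at_ tb] := tab.
have tin : a - 1 < t < b + 1 by lra.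
have [dG DG] := Dp t tin.
(* Inside the open interval clamping is the identity, so the fixed point equation makes [p] coincide
   locally with the antiderivative [G p]. *)
have nr : \forall x \near t, G p x = p x.
  near=> x; rewrite [RHS]Tp /T /c clamp_id//.
  apply/andP; split; apply: ltW.
    by near: x; exact: lt_nbhsr.
  by near: x; exact: lt_nbhsl.
have := near_eq_is_derive nr (derivableP dG).
have ct : c t = t by apply: clamp_id; rewrite !ltW.
rewrite DG ct => -[dp Dpt].
by split; [exact: dp|exact: Dpt|have [_] := admp; exact].
Unshelve. all: by end_near. Qed.

(** Continuity at [z0] bounds each map nearby with slack 1, and finiteness of [I] provides a common
    ball. *)
Lemma locally_bounded_family (V W : normedModType R) (I : finType)
    (g : I -> V -> W) (z0 : V) : (forall i, continuous (g i)) ->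
  exists2 e : R, 0 < e & forall z, ball z0 e z -> forall i, `|g i z| <= `|g i z0| + 1.
Proof.
move=> cg.
have N : \forall z \near z0, forall i, `|g i z| <= `|g i z0| + 1.
  apply: filter_forall => i; have /cvgrPdist_le/(_ 1 ltr01) := cg i z0.
  apply: filterS => z h; rewrite -[g i z](subrK (g i z0)).
  by apply: le_trans (ler_normD _ _) _; rewrite addrC lerD2l distrC.
by have [e /= e0 He] := (nbhs_ballP _ _).1 N; exists e.
Qed.

Lemma is_diff_pairl (V W : normedModType R) (t : V) (x : W) :
  is_diff x (fun y => (t, y)) (fun w => (0, w)).
Proof. exact: is_diff_pair. Qed.

Lemma differentiable_snd (U V W : normedModType R) (F : U * V -> W) t x :
  differentiable F (t, x) -> differentiable (fun y => F (t, y)) x.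
Proof.
move=> dF; have dp := is_diff_pairl t x.
exact: (@differentiable_comp _ _ _ _ (fun y => (t, y)) F).
Qed.

Lemma derive_snd (U V W : normedModType R) (F : U * V -> W) t x w :
  differentiable F (t, x) -> 'D_w (fun y => F (t, y)) x = 'D_(0, w) F (t, x).
Proof.
move=> dF; have dp := is_diff_pairl t x.
rewrite (@derive_compE _ _ _ _ (fun y => (t, y)) F)//.
by congr ('D_ _ F _); rewrite deriveE// diff_val.
Qed.

(** [M] comes from continuity of [F]; the Lipschitz constant [L] comes from local bounds on the
    spatial partial derivatives, by the mean value theorem on the segment from [y] to [x]. *)
Lemma smooth_local_bounds n (F : R * 'rV[R]_n -> 'rV[R]_n) (t0 : R)
    (p0 : 'rV[R]_n) (U : set 'rV[R]_n) :
  smooth F -> nbhs p0 U -> exists r M L : R,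
  [/\ 0 < r, 0 <= M, 0 <= L, (forall x : 'rV[R]_n, `|x - p0| <= r -> U x) &
    (forall t x, `|t - t0| <= r -> `|x - p0| <= r -> `|F (t, x)| <= M) /\
    (forall t x y, `|t - t0| <= r -> `|x - p0| <= r -> `|y - p0| <= r ->
     `|F (t, x) - F (t, y)| <= L * `|x - y|)].
Proof.
move=> sF Up0.
pose z0 := (t0, p0).
pose e_ j : R * 'rV[R]_n := (0, delta_mx 0 j).
have sDF j : smooth ('D_(e_ j) F) by exact: smooth_derive.
pose K := \sum_(j < n) (`|'D_(e_ j) F z0| + 1).
have [e1 e10 H1] := @locally_bounded_family _ _ 'I_1 (fun=> F) z0
  (fun=> smooth_continuous sF).
have [e2 e20 H2] := @locally_bounded_family _ _ 'I_n (fun j => 'D_(e_ j) F) z0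
  (fun j => smooth_continuous (sDF j)).
have [e3 /= e30 H3] := (nbhs_ballP _ _).1 Up0.
pose e := Num.min e1 (Num.min e2 e3).
have e0 : 0 < e by rewrite !lt_min e10 e20.
have He z : ball z0 e z -> [/\ U z.2, `|F z| <= `|F z0| + 1 &
    forall j, `|'D_(e_ j) F z| <= `|'D_(e_ j) F z0| + 1].
  move=> zb; split.
  - apply: H3; have [_ /=] := zb; apply: le_ball.
    by rewrite /e !ge_min lexx !orbT.
  - apply: (H1 z _ ord0); apply: le_ball zb.
    by rewrite /e !ge_min lexx.
  - apply: (H2 z); apply: le_ball zb.
    by rewrite /e !ge_min lexx orbT.
have Hin t x : `|t - t0| <= e / 2 -> `|x - p0| <= e / 2 -> ball z0 e (t, x).
  move=> ht hx; split; rewrite -ball_normE/= distrC.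
    by apply: le_lt_trans ht _; rewrite ltr_pdivrMr// mulr_natr mulr2n ltrDl.
  by apply: le_lt_trans hx _; rewrite ltr_pdivrMr// mulr_natr mulr2n ltrDl.
have K0 : 0 <= K by apply: sumr_ge0 => j _; rewrite addr_ge0.
(* Halving the radius places the closed balls of the statement inside the open ball where the bounds
   hold. *)
exists (e / 2), (`|F z0| + 1), K; split=> //.
- by rewrite divr_gt0.
- move=> x hx; have [] // := He (t0, x).
  by apply: Hin => //; rewrite subrr normr0 divr_ge0// ltW.
split=> [t x ht hx|t x y ht hx hy].
  by have [] := He _ (Hin _ _ ht hx).
apply/le_norm_rVP => [|i]; first by rewrite mulr_ge0.
rewrite !mxE.
have sFi : smooth (fun z => F z 0 i) by exact: ((smooth_rVP F).1 sF).
have [|s /andP[s0 s1]] := @mvt_line R _ (fun z => F z 0 i) (t, y) (0, x - y) 1 ler01.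
  by move=> z; exact: smooth_differentiable.
rewrite scale1r mul1r.
have -> : (t, y) + (0, x - y) = (t, x) :> R * 'rV[R]_n.
  by congr pair; rewrite /= ?addr0// addrC subrK.
move=> ->.
set z := (t, y) + _.
have hz : ball z0 e z.
  have -> : z = (t, y + s *: (x - y)).
    by rewrite /z; congr pair; rewrite /= scaler0 addr0.
  apply: Hin => //.
  (* A convex combination, so the intermediate point is no farther than [e / 2] from [p0]. *)
  have -> : y + s *: (x - y) - p0 = s *: (x - p0) + (1 - s) *: (y - p0).
    apply/rowP => j; rewrite !mxE; ring.
  apply: le_trans (ler_normD _ _) _; rewrite !normrZ !ger0_norm ?subr_ge0//.
  have h1 := ler_wpM2l s0 hx.
  have h2 : (1 - s) * `|y - p0| <= (1 - s) * (e / 2) by rewrite ler_wpM2l// subr_ge0.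
  lra.
have [_ _ B] := He _ hz.
have dF : differentiable F z by exact: smooth_differentiable.
rewrite -derive_rV; last exact: diff_derivable.
have -> : 'D_(0, x - y) F z = \sum_(j < n) (x - y) 0 j *: 'D_(e_ j) F z.
  move: dF; rewrite [z]surjective_pairing => dF.
  rewrite -derive_snd// derive_rV_basis; last exact: differentiable_snd.
  by apply: eq_bigr => j _; rewrite derive_snd.
rewrite summxE; apply: le_trans (ler_norm_sum _ _ _) _.
rewrite /K mulr_suml; apply: ler_sum => j _.
rewrite mxE normrM mulrC; apply: ler_pM => //.
  apply: le_trans (B j).
  exact: ((le_norm_rVP _ (normr_ge0 _)).1 (lexx _)).
exact: ((le_norm_rVP _ (normr_ge0 _)).1 (lexx _)).
Qed.

Lemma picard_lindelof n (F : R * 'rV[R]_n -> 'rV[R]_n) (t0 : R)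
    (p0 : 'rV[R]_n) (U : set 'rV[R]_n) :
  smooth F -> nbhs p0 U -> exists a b (p : R -> 'rV[R]_n),
  [/\ a < t0 < b, p t0 = p0 & forall t, a < t < b ->
    [/\ derivable p t 1, 'D_1 p t = F (t, p t) & U (p t)]].
Proof.
move=> sF /(smooth_local_bounds t0 sF)[r [M [L [r0 M0 L0 rU [FM FL]]]]].
(* The three terms give [d <= r], [d * M <= r] and [d * L <= 1 / 2]; adding 1 keeps the denominators
   positive when [M] or [L] is 0. *)
pose d := Num.min r (Num.min (r / (M + 1)) (1 / (2 * (L + 1)))).
have M1 : 0 < M + 1 by rewrite ltr_wpDl.
have L1 : 0 < L + 1 by rewrite ltr_wpDl.
have d0 : 0 < d by rewrite !lt_min r0 !divr_gt0// mulr_gt0.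
have dr : d <= r by rewrite ge_min lexx.
have dM : d * M <= r.
  apply: (@le_trans _ _ (r / (M + 1) * (M + 1))); last by rewrite divfK// gt_eqF.
  apply: ler_pM => //; first exact: ltW.
    by rewrite /d !ge_min lexx orbT.
  by rewrite lerDl.
have dL : d * L <= 1 / 2.
  apply: (@le_trans _ _ (1 / (2 * (L + 1)) * (L + 1))).
    apply: ler_pM => //; first exact: ltW.
      by rewrite /d !ge_min lexx !orbT.
    by rewrite lerDl.
  by rewrite invfM mulrA divfK// gt_eqF.
have [||p [p0E Hp]] := @picard_iteration n F t0 p0 r d M L d0 (ltW r0) M0 L0 dM dL
  (smooth_continuous sF).
- by move=> t x ht; apply: FM; exact: le_trans dr.
- by move=> t x y ht; apply: FL; exact: le_trans dr.
exists (t0 - d), (t0 + d), p; split=> //.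
  by rewrite ltrBlDr ltrDl d0.
by move=> t /Hp[? ? /rU].
Qed.
End PicardLindelof.

(** * Generated Lie algebras, related vector fields and finite-dimensional subspaces *)

Section LieFields.
Context {R : realType}.

Lemma VLie_lie_closed n (X : tvfield R n) : lie_closed (VLie X).
Proof.
split=> [S [S0 _ _] _ //|a b Y Z VY VZ S cS SX|Y Z VY VZ S cS SX].
  by have [_ SD _] := cS; apply: SD; [exact: VY|exact: VZ].
by have [_ _ SB] := cS; apply: SB; [exact: VY|exact: VZ].
Qed.

Lemma VLie_gen n (X : tvfield R n) t : VLie X (X t).
Proof. by move=> S _. Qed.

Lemma smooth_lie_bracket n (Y Z : vfield R n) :
  smooth Y -> smooth Z -> smooth (lie_bracket Y Z).
Proof. by move=> sY sZ; apply: smoothB; exact: smooth_derive_along. Qed.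

Lemma smooth_lie_closed n : lie_closed (fun Y : vfield R n => smooth Y).
Proof.
split; [exact: smooth_cst|move=> a b Y Z; exact: smooth_lin_comb|].
exact: smooth_lie_bracket.
Qed.

Lemma smooth_pairl (U V W : normedModType R) (F : U * V -> W) t :
  smooth F -> smooth (fun x => F (t, x)).
Proof.
move=> sF; apply: (@smooth_comp_affine _ _ _ _ (fun x => (t, x)) (fun v => (0, v))) => //.
move=> x v; have [dp Dp] := is_diff_pairl t x.
by rewrite deriveE// Dp.
Qed.

Lemma smooth_pairr (U V W : normedModType R) (F : U * V -> W) y :
  smooth F -> smooth (fun x => F (x, y)).
Proof.
move=> sF.
have dp x : is_diff x (fun x : U => (x, y)) (fun v : U => (v, 0 : V)).
  exact: is_diff_pair.
apply: (@smooth_comp_affine _ _ _ _ (fun x => (x, y)) (fun v => (v, 0))) => //.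
by move=> x v; have [d D] := dp x; rewrite deriveE// D.
Qed.

Lemma tsmooth_smooth n (X : tvfield R n) t : tsmooth X -> smooth (X t).
Proof. exact: smooth_pairl. Qed.

(** By minimality of [VLie X], since smooth fields form a Lie-closed set containing every [X t]. *)
Lemma VLie_smooth n (X : tvfield R n) Y : tsmooth X -> VLie X Y -> smooth Y.
Proof.
move=> sX; apply; first exact: smooth_lie_closed.
by move=> t; exact: tsmooth_smooth.
Qed.

(** In the last term the direction is frozen at [Z x]. Symmetry of second derivatives is used in
    each summand, to recognise the derivative of ['D_v f] along [Z x], and once more to exchange [v]
    and [Z x]. *)
Lemma derive_derive_alongE n m (Z : vfield R n) (f : 'rV[R]_n -> 'rV[R]_m) x v :
  smooth Z -> smooth f ->
  'D_v (fun y => 'D_(Z y) f y) x = 'D_('D_v Z x) f x + 'D_v ('D_(Z x) f) x.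
Proof.
move=> sZ sf.
have dvf : differentiable ('D_v f) x by exact/smooth_differentiable/smooth_derive.
have E : \sum_(j < n) Z x 0 j *: 'D_v ('D_(delta_mx 0 j) f) x = 'D_v ('D_(Z x) f) x.
  apply: (etrans _ (derive_comm x (Z x) v sf)).
  apply: (etrans _ (esym (derive_rV_basis (Z x) dvf))).
  apply: eq_bigr => j _.
  exact: (congr1 (fun y => Z x 0 j *: y) (derive_comm x v (delta_mx 0 j) sf)).
exact: (etrans (derive_derive_along x v sZ sf) (congr1 (fun y => _ + y) E)).
Qed.

(** Differentiate the second relation along [Z1 p]: the Leibniz rule gives the left side, the chain
    rule and the first relation give the right side. *)
Lemma f_related_derive n m (f : 'rV[R]_n -> 'rV[R]_m) Z1 Z2 Y1 Y2 p :
  smooth f -> smooth Z2 -> smooth Y2 ->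
  f_related f Z1 Y1 -> f_related f Z2 Y2 ->
  'D_('D_(Z1 p) Z2 p) f p + 'D_(Z1 p) ('D_(Z2 p) f) p = 'D_(Y1 (f p)) Y2 (f p).
Proof.
move=> sf sZ2 sY2 r1 r2.
apply: (etrans (esym (derive_derive_alongE p (Z1 p) sZ2 sf))).
have -> : (fun y => 'D_(Z2 y) f y) = Y2 \o f by apply/funext => y; exact: r2.
by rewrite derive_compE ?r1//; exact: smooth_differentiable.
Qed.

(** Subtract the two instances of [f_related_derive]; their second-order terms cancel by
    symmetry. *)
Lemma f_related_lie_bracket n m (f : 'rV[R]_n -> 'rV[R]_m) Z1 Z2 Y1 Y2 :
  smooth f -> smooth Z1 -> smooth Z2 -> smooth Y1 -> smooth Y2 ->
  f_related f Z1 Y1 -> f_related f Z2 Y2 ->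
  f_related f (lie_bracket Z1 Z2) (lie_bracket Y1 Y2).
Proof.
move=> sf sZ1 sZ2 sY1 sY2 r1 r2 p.
have E12 := f_related_derive p sf sZ2 sY2 r1 r2.
have E21 := f_related_derive p sf sZ1 sY1 r2 r1.
have C := derive_comm p (Z1 p) (Z2 p) sf.
have L := derive_lin_comb 1 (-1) ('D_(Z1 p) Z2 p) ('D_(Z2 p) Z1 p)
  (smooth_differentiable p sf).
rewrite !scale1r !scaleN1r in L.
have sub_symmetric (V : zmodType) (a b x y u v w : V) :
    x + u = a -> y + v = b -> u = v -> w = x - y -> w = a - b.
  by move=> <- <- -> ->; rewrite opprD addrACA subrr addr0.
exact: (sub_symmetric _ _ _ _ _ _ _ _ E12 E21 C L).
Qed.

Lemma f_related_lin_comb n m (f : 'rV[R]_n -> 'rV[R]_m) a b Z1 Z2 Y1 Y2 :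
  smooth f -> f_related f Z1 Y1 -> f_related f Z2 Y2 ->
  f_related f (fun p => a *: Z1 p + b *: Z2 p) (fun y => a *: Y1 y + b *: Y2 y).
Proof.
move=> sf r1 r2 p; rewrite derive_lin_comb ?r1 ?r2//.
exact: smooth_differentiable.
Qed.

(** Relatedness prescribes the target field on the range of [f]; density and continuity do the
    rest. *)
Lemma f_related_unique n m (f : 'rV[R]_n -> 'rV[R]_m) Z Y Y' :
  dense (range f) -> smooth Y -> smooth Y' ->
  f_related f Z Y -> f_related f Z Y' -> Y = Y'.
Proof.
move=> df sY sY' r r'.
apply: (dense_eq_continuous df (smooth_continuous sY) (smooth_continuous sY')).
by move=> _ [p _ <-]; rewrite -r -r'.
Qed.

(** [lie_system] asks for generators inside the algebra, whereas the family [B] may lie outside [S].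
    The new generators are combinations of [B] given by the rows of a matrix, possibly linearly
    dependent. *)
Lemma finite_dim_subspace n (I : finType) (B : I -> vfield R n) (S : set (vfield R n)) :
  S (fun=> 0) ->
  (forall (a b : R) Y Z, S Y -> S Z -> S (fun x => a *: Y x + b *: Z x)) ->
  (forall Y, S Y -> exists c : I -> R, forall x, Y x = \sum_i c i *: B i x) ->
  exists (d : nat) (B' : 'I_d -> vfield R n), (forall i, S (B' i)) /\
    forall Y, S Y -> exists c : 'I_d -> R, forall x, Y x = \sum_(i < d) c i *: B' i x.
Proof.
move=> S0 SL SB; set d := #|I|.
pose comb (u : 'rV[R]_d) : vfield R n := fun x => \sum_(i < d) u 0 i *: B (enum_val i) x.
have combL a b u v : comb (a *: u + b *: v) = fun x => a *: comb u x + b *: comb v x.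
  apply/funext => x; rewrite /comb !scaler_sumr -big_split/=; apply: eq_bigr => i _.
  by rewrite !mxE scalerDl !scalerA.
(* A subspace of the coefficient space of maximal rank mapped into [S] by [comb]. *)
pose P r := `[< exists2 M : 'M[R]_d, \rank M = r & forall u, (u <= M)%MS -> S (comb u) >].
have P0 : exists r, P r.
  exists 0; apply/asboolP; exists 0; first by rewrite mxrank0.
  move=> u; rewrite submx0 => /eqP ->; rewrite (_ : comb 0 = fun=> 0)//.
  by apply/funext => x; apply: big1 => i _; rewrite mxE scale0r.
have Pd r : P r -> (r <= d)%N by move=> /asboolP[M <- _]; exact: rank_leq_row.
have [r /asboolP[M Mr MS] rmax] := ex_maxnP P0 Pd.
exists d, (fun i => comb (row i M)); split=> [i|Y SY]; first exact/MS/row_sub.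
have [c cE] := SB _ SY.
pose u := \row_(i < d) c (enum_val i).
have Yu : Y = comb u.
  apply/funext => x; rewrite cE (reindex (fun i : 'I_#|I| => enum_val i))/=; last first.
    exact/onW_bij/enum_val_bij.
  by apply: eq_bigr => i _; rewrite mxE.
(* Otherwise adjoining [u] to [M] would raise the rank while [comb] still maps the row space into
   [S], against maximality of [r]. *)
have uM : (u <= M)%MS.
  apply: contrapT => /negP uM.
  have : P (\rank (M + u)%MS).
    apply/asboolP; exists (M + u)%MS => // v /sub_addsmxP[[w1 w2]] /= ->.
    have -> : w1 *m M + w2 *m u = 1 *: (w1 *m M) + w2 0 0 *: u.
      by rewrite scale1r [w2]mx11_scalar mul_scalar_mx !mxE eqxx.
    by rewrite combL; apply: SL; [apply/MS; exact: submxMl|rewrite -Yu].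
  move=> /rmax; rewrite -Mr leqNgt => /negP; apply.
  by apply: rank_ltmx; rewrite ltmxE addsmxSl addsmx_sub submx_refl/=.
have [w uE] : exists w, u = w *m M by apply/submxP.
exists (fun i => w 0 i) => x; rewrite Yu uE.
under [RHS]eq_bigr do rewrite /comb scaler_sumr.
rewrite exchange_big; apply: eq_bigr => i _ /=.
by rewrite mxE scaler_suml; apply: eq_bigr => j _; rewrite mxE scalerA.
Qed.

Lemma lie_system_spanned n (X : tvfield R n) (I : finType) (B : I -> vfield R n) :
  (forall Y, VLie X Y -> exists c : I -> R, forall x, Y x = \sum_i c i *: B i x) ->
  lie_system X.
Proof.
by have [V0 VL _] := VLie_lie_closed X; move=> /(finite_dim_subspace V0 VL).
Qed.
End LieFields.

(** * Vector fields on the product space and the direct product of Lie systems *)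

Section DirectProduct.
Context {R : realType} (m : nat) (ns : 'I_m -> nat).

(** Time-independent counterpart of [direct_product], whose slice at [t] is the product of the
    fields [Xs a t]. *)
Definition product_field (Ys : forall a, vfield R (ns a)) : vfield R (prod_dim ns) :=
  fun p => \mxrow_(a < m) Ys a (submxrow p a).

Lemma differentiable_submxrow a (p : 'rV[R]_(prod_dim ns)) :
  differentiable (fun q : 'rV[R]_(prod_dim ns) => submxrow q a) p.
Proof.
apply/differentiable_rVP => j.
have -> : (fun q : 'rV[R]_(prod_dim ns) => submxrow q a 0 j) =
          fun q => q 0 (tagnat.Rank a j) by apply/funext => q; rewrite mxE.
exact: differentiable_coord.
Qed.

Lemma derive_submxrow a (p v : 'rV[R]_(prod_dim ns)) :
  'D_v (fun q : 'rV[R]_(prod_dim ns) => submxrow q a) p = submxrow v a.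
Proof.
apply/rowP => j; rewrite derive_rV; last exact/diff_derivable/differentiable_submxrow.
have -> : (fun q : 'rV[R]_(prod_dim ns) => submxrow q a 0 j) =
          fun q => q 0 (tagnat.Rank a j) by apply/funext => q; rewrite mxE.
rewrite -(@derive_rV R _ _ id); last exact: derivable_id.
by rewrite derive_id mxE.
Qed.

(** Each coordinate is a component of a single [Ys a] composed with the linear projection onto block
    [a]. *)
Lemma smooth_product_field (Ys : forall a, vfield R (ns a)) :
  (forall a, smooth (Ys a)) -> smooth (product_field Ys).
Proof.
move=> sY; apply/smooth_rVP => j.
have -> : (fun p => product_field Ys p 0 j) =
    fun p => (fun x => Ys (tagnat.sig1 j) x 0 (tagnat.sig2 j)) (submxrow p (tagnat.sig1 j)).
  by apply/funext => p; rewrite mxE.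
apply: (@smooth_comp_affine R _ _ _ (fun p => submxrow p (tagnat.sig1 j))
  (fun v => submxrow v (tagnat.sig1 j)) (fun x => Ys (tagnat.sig1 j) x 0 (tagnat.sig2 j))).
- by move=> x; exact: differentiable_submxrow.
- by move=> x v; exact: derive_submxrow.
- exact: ((smooth_rVP (Ys _)).1 (sY _)).
Qed.

Lemma derive_product_field (Ys : forall a, vfield R (ns a)) p v :
  (forall a, smooth (Ys a)) ->
  'D_v (product_field Ys) p = \mxrow_(a < m) 'D_(submxrow v a) (Ys a) (submxrow p a).
Proof.
move=> sY; apply/rowP => j; rewrite derive_rV; last first.
  exact/smooth_derivable/smooth_product_field.
rewrite mxE; set a := tagnat.sig1 j; set i := tagnat.sig2 j.
have -> : (fun p => product_field Ys p 0 j) =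
    (fun x => Ys a x 0 i) \o (fun p => submxrow p a).
  by apply/funext => q; rewrite mxE.
have sYi : smooth (fun x => Ys a x 0 i) by exact: ((smooth_rVP (Ys a)).1 (sY a)).
rewrite derive_compE; [|exact: differentiable_submxrow|exact: smooth_differentiable].
by rewrite derive_submxrow derive_rV//; exact: smooth_derivable.
Qed.

(** Each block of a product field depends only on the variables of that block, so no cross terms
    arise. *)
Lemma lie_bracket_product_field (Ys Zs : forall a, vfield R (ns a)) :
  (forall a, smooth (Ys a)) -> (forall a, smooth (Zs a)) ->
  lie_bracket (product_field Ys) (product_field Zs) =
  product_field (fun a => lie_bracket (Ys a) (Zs a)).
Proof.
move=> sY sZ; apply/funext => p; rewrite /lie_bracket !derive_product_field//.
rewrite -mxrowB; apply: eq_mxrow => a.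
by rewrite /product_field !mxrowK.
Qed.

Lemma is_diff_fst (V W : normedModType R) (z : V * W) :
  is_diff z (fst : V * W -> V) fst.
Proof.
have c : continuous (fst : V * W -> V) by move=> x; exact: cvg_fst.
by apply: DiffDef; [exact: linear_differentiable|exact: diff_lin].
Qed.

Lemma is_diff_snd (V W : normedModType R) (z : V * W) :
  is_diff z (snd : V * W -> W) snd.
Proof.
have c : continuous (snd : V * W -> W) by move=> x; exact: cvg_snd.
by apply: DiffDef; [exact: linear_differentiable|exact: diff_lin].
Qed.

Lemma tsmooth_direct_product (Xs : forall a, tvfield R (ns a)) :
  (forall a, tsmooth (Xs a)) -> tsmooth (direct_product Xs).
Proof.
move=> sX; apply/smooth_rVP => j.
set a := tagnat.sig1 j; set i := tagnat.sig2 j.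
have -> : (fun z : R * 'rV[R]_(prod_dim ns) => direct_product Xs z.1 z.2 0 j) =
    fun z => (fun y => Xs a y.1 y.2 0 i) (z.1, submxrow z.2 a).
  by apply/funext => z; rewrite mxE.
have dA (z : R * 'rV[R]_(prod_dim ns)) :
    is_diff z (fun z => (z.1, submxrow z.2 a)) (fun v => (v.1, submxrow v.2 a)).
  apply: is_diff_pair; first exact: is_diff_fst.
  apply: (@is_diff_comp _ _ _ _ snd snd (fun p => submxrow p a) (fun p => submxrow p a)).
    exact: is_diff_snd.
  apply: DiffDef; first exact: differentiable_submxrow.
  apply/funext => v; rewrite -deriveE; first exact: derive_submxrow.
  exact: differentiable_submxrow.
apply: (@smooth_comp_affine R _ _ _
  (fun z : R * 'rV[R]_(prod_dim ns) => (z.1, submxrow z.2 a) : R * 'rV[R]_(ns a))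
  (fun v : R * 'rV[R]_(prod_dim ns) => (v.1, submxrow v.2 a))
  (fun y : R * 'rV[R]_(ns a) => Xs a y.1 y.2 0 i)).
- by move=> z; have [] := dA z.
- by move=> z v; have [d D] := dA z; rewrite deriveE// D.
- exact: ((smooth_rVP (fun z => Xs a z.1 z.2)).1 (sX a)).
Qed.

(** By minimality: products of fields from the factor algebras form a Lie-closed set containing
    every slice. This is an inclusion into the direct sum. *)
Lemma VLie_direct_product (Xs : forall a, tvfield R (ns a)) Z :
  (forall a, tsmooth (Xs a)) -> VLie (direct_product Xs) Z ->
  exists2 Ys, (forall a, VLie (Xs a) (Ys a)) & Z = product_field Ys.
Proof.
move=> sX VZ0.
apply: (VZ0 [set Z | exists2 Ys, (forall a, VLie (Xs a) (Ys a)) & Z = product_field Ys]);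
  last first.
  by move=> t; exists (fun a => Xs a t) => // a; exact: VLie_gen.
split.
- exists (fun a => fun=> 0); last by apply/funext => p; rewrite /product_field mxrow0.
  by move=> a; have [] := VLie_lie_closed (Xs a).
- move=> b c _ _ [Ys VY ->] [Zs VZ ->].
  exists (fun a x => b *: Ys a x + c *: Zs a x).
    by move=> a; have [_ VL _] := VLie_lie_closed (Xs a); exact: VL.
  by apply/funext => p; apply/rowP => j; rewrite !mxE.
- move=> _ _ [Ys VY ->] [Zs VZ ->].
  exists (fun a => lie_bracket (Ys a) (Zs a)).
    by move=> a; have [_ _ VB] := VLie_lie_closed (Xs a); exact: VB.
  by apply: lie_bracket_product_field => a; apply: VLie_smooth (sX a) _.
Qed.

Lemma lie_system_direct_product (Xs : forall a, tvfield R (ns a)) :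
  (forall a, tsmooth (Xs a)) -> (forall a, lie_system (Xs a)) ->
  lie_system (direct_product Xs).
Proof.
move=> sX lX.
have /choice[d Hd] : forall a, exists d (B : 'I_d -> vfield R (ns a)),
    (forall i, VLie (Xs a) (B i)) /\
    forall Y, VLie (Xs a) Y -> exists c : 'I_d -> R,
      forall x, Y x = \sum_(i < d) c i *: B i x by exact: lX.
pose B a := sval (cid (Hd a)).
(* A block of rows of the identity: multiplying by it places a vector in block [a] and zeros
   elsewhere. *)
pose E a : 'M[R]_(ns a, prod_dim ns) := submxcol 1%:M a.
apply: (@lie_system_spanned _ _ _ {a : 'I_m & 'I_(d a)}
  (fun s p => B (tag s) (tagged s) (submxrow p (tag s)) *m E (tag s))).
move=> Z /(VLie_direct_product sX)[Ys VY ->].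
have HB a : exists c : 'I_(d a) -> R, forall x, Ys a x = \sum_(i < d a) c i *: B a i x.
  by have [_] := svalP (cid (Hd a)); exact.
pose c a := sval (cid (HB a)).
exists (fun s => c (tag s) (tagged s)) => p.
rewrite -(@sig_big_dep _ _ _ _ _ xpredT (fun=> xpredT)
  (fun a i => c a i *: (B a i (submxrow p a) *m E a)))/=.
have -> : product_field Ys p = \sum_a Ys a (submxrow p a) *m E a.
  by rewrite -mul_mxrow_mxcol submxcolK mulmx1.
apply: eq_bigr => a _; rewrite (svalP (cid (HB a))) mulmx_suml.
by apply: eq_bigr => i _; rewrite scalemxAl.
Qed.
End DirectProduct.

(** * Projection of the product system by the superposition map, and the epimorphism *)

Lemma superposition_projects (R : realType) (n0 m : nat) (ns : 'I_m -> nat)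
    (X : tvfield R n0) (Xs : forall a : 'I_m, tvfield R (ns a))
    (Phi : 'rV[R]_(prod_dim ns) -> 'rV[R]_n0 -> 'rV[R]_n0) (k : 'rV[R]_n0) (t0 : R) :
  tsmooth X -> (forall a, tsmooth (Xs a)) -> mixed_superposition_rule X Xs Phi ->
  f_related (fun p => Phi p k) (direct_product Xs t0) (X t0).
Proof.
move=> sX sXs [sPhi [G [oG dG _ sol]]].
have sXhat := tsmooth_direct_product sXs.
have sPhik : smooth (fun p => Phi p k) := smooth_pairr k sPhi.
suff E : (fun p => 'D_(direct_product Xs t0 p) (fun q => Phi q k) p) =
         (fun p => X t0 (Phi p k)) by move=> p; exact: (congr1 (@^~ p) E).
apply: (dense_eq_continuous dG).
- apply/smooth_continuous/smooth_derive_along => //; exact: tsmooth_smooth.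
- move=> p; apply: (@continuous_comp _ _ _ (fun q => Phi q k) (X t0)).
    exact: smooth_continuous.
  exact/smooth_continuous/tsmooth_smooth.
move=> p0 Gp0.
have Gn : nbhs p0 G by exact: open_nbhs_nbhs.
have [a [b [p [t0ab pt0 Hp]]]] := picard_lindelof t0 sXhat Gn.
have ab : a < b by have /andP[] := t0ab; exact: lt_trans.
have [|t /Hp[_ _]//|+ _] := sol a b p ab.
  by move=> t /Hp[d D _].
(* The image curve solves [X], so its velocity at [t0] is the right side; the chain rule computes
   the same velocity as the left side. *)
move=> /(_ k t0 t0ab)[_]; rewrite pt0 => <-.
have [dp Dp _] := Hp t0 t0ab.
rewrite (@derive_compE R _ _ _ p (fun q => Phi q k)).
- by rewrite Dp/= pt0.
- exact/derivable1_diffP.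
- exact: smooth_differentiable.
Qed.

Theorem mainTheorem8 (R : realType) (n0 m : nat) (ns : 'I_m -> nat)
    (X : tvfield R n0) (Xs : forall a : 'I_m, tvfield R (ns a))
    (Phi : 'rV[R]_(prod_dim ns) -> 'rV[R]_n0 -> 'rV[R]_n0)
    (k : 'rV[R]_n0) :
  tsmooth X -> (forall a, tsmooth (Xs a)) ->
  mixed_superposition_rule X Xs Phi ->
  (forall a, lie_system (Xs a)) ->
  open (range (fun p => Phi p k)) -> dense (range (fun p => Phi p k)) ->
  let Xhat := direct_product Xs in
  let Phik := fun p => Phi p k in
  lie_system Xhat /\
  exists phi : vfield R (prod_dim ns) -> vfield R n0,
    [/\ (forall Z, VLie Xhat Z ->
           [/\ smooth (phi Z), f_related Phik Z (phi Z) & VLie X (phi Z)]),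
        (forall (a b : R) Z1 Z2, VLie Xhat Z1 -> VLie Xhat Z2 ->
           phi (fun p => a *: Z1 p + b *: Z2 p)
           = (fun x => a *: phi Z1 x + b *: phi Z2 x)),
        (forall Z1 Z2, VLie Xhat Z1 -> VLie Xhat Z2 ->
           phi (lie_bracket Z1 Z2) = lie_bracket (phi Z1) (phi Z2)),
        (forall Y, VLie X Y -> exists2 Z, VLie Xhat Z & phi Z = Y)
      & (forall t, phi (Xhat t) = X t)].
Proof.
move=> sX sXs rule lXs _ dP Xhat Phik.
have sXhat : tsmooth Xhat by exact: tsmooth_direct_product.
have sPhik : smooth Phik by have [sPhi _] := rule; exact: (smooth_pairr k sPhi).
have rX t : f_related Phik (Xhat t) (X t) by exact: superposition_projects.
have [V0 VL VB] := VLie_lie_closed X.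
have [V0' VL' VB'] := VLie_lie_closed Xhat.
have uniq Z Y Y' : VLie X Y -> VLie X Y' ->
    f_related Phik Z Y -> f_related Phik Z Y' -> Y = Y'.
  by move=> VY VY'; apply: f_related_unique => //; exact: VLie_smooth sX _.
have r0 : f_related Phik (fun=> 0) (fun=> 0) by move=> p; exact: derive0.
split; first exact: lie_system_direct_product.
have proj Z : VLie Xhat Z -> exists2 Y, VLie X Y & f_related Phik Z Y.
  (* Smoothness of [Z] is carried through the minimality argument because relatedness of brackets
     requires it. *)
  move=> VZ; suff [] : smooth Z /\ exists2 Y, VLie X Y & f_related Phik Z Y by [].
  apply: (VZ [set Z | smooth Z /\ exists2 Y, VLie X Y & f_related Phik Z Y]); last first.
    by move=> t; split; [exact: tsmooth_smooth|exists (X t) => //; exact: VLie_gen].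
  split=> [|a b Z1 Z2|Z1 Z2].
  - by split; [exact: smooth_cst|exists (fun=> 0)].
  - move=> [s1 [Y1 VY1 r1]] [s2 [Y2 VY2 r2]]; split; first exact: smooth_lin_comb.
    by eexists; [exact: (VL a b _ _ VY1 VY2)|exact: f_related_lin_comb].
  - move=> [s1 [Y1 VY1 r1]] [s2 [Y2 VY2 r2]]; split; first exact: smooth_lie_bracket.
    exists (lie_bracket Y1 Y2); first exact: VB.
    by apply: f_related_lie_bracket => //; exact: VLie_smooth sX _.
(* The related field in [VLie X], unique by [uniq], with default 0 for a field [Z] that has none. *)
pose phi Z := xget (fun=> 0) [set Y | VLie X Y /\ f_related Phik Z Y].
have phiP Z : VLie Xhat Z -> VLie X (phi Z) /\ f_related Phik Z (phi Z).
  move=> /proj[Y VY rY].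
  exact: (@xgetPex _ _ [set Y | _ /\ _] (ex_intro _ Y (conj VY rY))).
(* This turns every identity about [phi] into a statement of relatedness between members of the two
   algebras. *)
have phiE Z Y : VLie Xhat Z -> VLie X Y -> f_related Phik Z Y -> phi Z = Y.
  by move=> /phiP[V r] VY rY; exact: (uniq Z).
exists phi; split.
- by move=> Z /phiP[V r]; split=> //; exact: VLie_smooth sX V.
- move=> a b Z1 Z2 V1 V2; have [VY1 r1] := phiP _ V1; have [VY2 r2] := phiP _ V2.
  apply: phiE; [exact: VL'|exact: VL|exact: f_related_lin_comb].
- move=> Z1 Z2 V1 V2; have [VY1 r1] := phiP _ V1; have [VY2 r2] := phiP _ V2.
  apply: phiE; [exact: VB'|exact: VB|].
  by apply: f_related_lie_bracket => //; [exact: VLie_smooth sXhat _|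
    exact: VLie_smooth sXhat _|exact: VLie_smooth sX _|exact: VLie_smooth sX _].
- move=> Y VY.
  (* Surjectivity by minimality of [VLie X]: its members related to some field of [VLie Xhat] form a
     Lie-closed set containing every [X t]. *)
  suff [Z VZ r] : exists2 Z, VLie Xhat Z & f_related Phik Z Y.
    by exists Z => //; exact: phiE.
  suff [] : VLie X Y /\ exists2 Z, VLie Xhat Z & f_related Phik Z Y by [].
  apply: (VY [set Y | VLie X Y /\ exists2 Z, VLie Xhat Z & f_related Phik Z Y]); last first.
    by move=> t; split; [exact: VLie_gen|exists (Xhat t) => //; exact: VLie_gen].
  split=> [|a b Y1 Y2|Y1 Y2].
  + by split=> //; exists (fun=> 0).
  + move=> [VY1 [Z1 V1 r1]] [VY2 [Z2 V2 r2]]; split; first exact: VL.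
    by eexists; [exact: (VL' a b _ _ V1 V2)|exact: f_related_lin_comb].
  + move=> [VY1 [Z1 V1 r1]] [VY2 [Z2 V2 r2]]; split; first exact: VB.
    exists (lie_bracket Z1 Z2); first exact: VB'.
    by apply: f_related_lie_bracket => //; [exact: VLie_smooth sXhat _|
      exact: VLie_smooth sXhat _|exact: VLie_smooth sX _|exact: VLie_smooth sX _].
- by move=> t; apply: phiE => //; exact: VLie_gen.
Qed.
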